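(* Let $n\ge 1$, let $\mathcal{T}=(\mathbb{C}^* )^n$, and let $R:\mathcal{T}^2\to\mathcal{T}^2$ be the rational map $R(\mathbf{x},\mathbf{y})=(\mathbf{x}',\mathbf{y}')$ determined by $$x_1'\cdots x_k'=y_1\cdots y_k+\Delta_k(\mathbf{x},\mathbf{y})\,\eta(\mathbf{x},\mathbf{y})\quad (1\le k\le n),\qquad x_i'y_i'=x_iy_i\quad(1\le i\le n).$$ Then $R$ is an involutive rational set-theoretical R-matrix; that is, $R$ is a birational isomorphism of $\mathcal{T}\times\mathcal{T}$ to itself satisfying $R^{21}R=1$ and the quantum Yang-Baxter equation $R_{12}R_{13}R_{23}=R_{23}R_{13}R_{12}$ as birational isomorphisms of $\mathcal{T}^3$.
   Context: Elements of $\mathcal{T}=(\mathbb{C}^* )^n$ are written $\mathbf{t}=[t_1,\dots,t_n]$. For $\mathbf{x},\mathbf{y}\in\mathcal{T}$ set $\Delta_1=1$ and, for $k\ge 2$, $$\Delta_k(\mathbf{x},\mathbf{y})=x_1\cdots x_{k-1}+x_1\cdots x_{k-2}y_k+\dots+y_2\cdots y_k=\sum_{j=1}^k x_1\cdots x_{j-1}\,y_{j+1}\cdots y_k,$$ and $$\eta(\mathbf{x},\mathbf{y})=\frac{x_1\cdots x_n-y_1\cdots y_n}{\Delta_n(\mathbf{x},\mathbf{y})}.$$ The displayed conditions determine $R$ uniquely as a rational map, and they imply $\prod_i x_i'=\prod_i x_i$. $R^{21}=PRP$, where $P(x,y)=(y,x)$ is the permutation of $\mathcal{T}\times\mathcal{T}$.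 $R_{ij}$ denotes the birational isomorphism of $\mathcal{T}^3$ acting by $R$ on the $i$-th and $j$-th components (in this order) and by the identity on the remaining one. All identities are identities of rational maps. *)

(* Defs.v *)
From HB Require Import structures.
From mathcomp Require Export all_boot all_order all_algebra.
From mathcomp Require Export fraction mpoly reals complex.

Set Implicit Arguments.
Unset Strict Implicit.
Unset Printing Implicit Defensive.

Import GRing.Theory.
Local Open Scope ring_scope.

(* T = (C^* )^n, and T^r is the r-fold power of T.  A point of T^r is an r x n
   matrix whose a-th row is its a-th component in T.  The field F stands for C. *)

Section RationalMaps.
Variables (F : fieldType) (n : nat).

(* The function field of T^r. *)
Definition ratfun (r : nat) : fieldType := {fraction {mpoly F[r * n]}}.

Definition coord (r : nat) : 'M[ratfun r]_(r, n) :=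
  \matrix_(a, i) tofrac 'X_(mxvec_index a i).

(* T^r is irreducible, so a rational map T^r --> T^s is a family of s * n
   nonzero elements of the function field of T^r. *)
Record ratmap (r s : nat) := RatMap {
  rat_mx :> 'M[ratfun r]_(s, n);
  rat_mx_neq0 : [forall a, [forall i, rat_mx a i != 0]]
}.

Definition poly_at (r s : nat) (p : {mpoly F[s * n]})
    (v : 'M[ratfun r]_(s, n)) : ratfun r :=
  mmap (@tofrac _ \o @mpolyC (r * n) F) (fun k => mxvec v 0 k) p.

(* [rat_value f v w]: the rational function f on T^s is defined at the generic
   value of v, i.e. f = p / q with q not identically zero along v, and the
   rational function f(v) on T^r is w. *)
Definition rat_value (r s : nat) (f : ratfun s) (v : 'M[ratfun r]_(s, n))
    (w : ratfun r) : Prop :=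
  exists p q : {mpoly F[s * n]},
    [/\ f = tofrac p / tofrac q, poly_at q v != 0
      & w = poly_at p v / poly_at q v].

Lemma poly_at_coord (r s : nat) (v : 'M[ratfun r]_(s, n)) a i :
  poly_at 'X_(mxvec_index a i) v = v a i.
Proof. by rewrite /poly_at mmapX mmap1U mxvecE. Qed.

Lemma rat_value_unique (r s : nat) (f : ratfun s) (v : 'M[ratfun r]_(s, n))
    w1 w2 : rat_value f v w1 -> rat_value f v w2 -> w1 = w2.
Proof.
move=> [p1 [q1 [-> q1v ->]]] [p2 [q2 [e q2v ->]]].
have q_neq0 (q : {mpoly F[s * n]}) : poly_at q v != 0 -> tofrac q != 0.
  by rewrite tofrac_eq0; apply: contraNneq => ->; rewrite /poly_at mmap0.
have polyM (p q : {mpoly F[s * n]}) :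
    poly_at (p * q) v = poly_at p v * poly_at q v.
  exact: rmorphM.
move/eqP: e; rewrite eqr_div ?q_neq0 // -!tofracM tofrac_eq => /eqP e.
by apply/eqP; rewrite eqr_div // -!polyM e.
Qed.

(* [is_comp f g h]: the composite of f after g is defined and equal to h. *)
Definition is_comp (r s t : nat) (f : ratmap s t) (g : ratmap r s)
    (h : ratmap r t) : Prop :=
  forall a i, rat_value (f a i) g (h a i).

Definition is_comp3 (r : nat) (f g h k : ratmap r r) : Prop :=
  exists2 gh : ratmap r r, is_comp g h gh & is_comp f gh k.

Lemma coord_map_subproof (r s : nat) (sigma : 'I_s -> 'I_r) :
  [forall a, [forall i, (\matrix_(a, i) coord r (sigma a) i) a i != 0]].
Proof.
apply/forallP => a; apply/forallP => i.
by rewrite !mxE tofrac_eq0 -msupp_eq0 msuppX.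
Qed.

(* (t_0, ..., t_(r-1)) |-> (t_(sigma 0), ..., t_(sigma (s-1))) *)
Definition coord_map (r s : nat) (sigma : 'I_s -> 'I_r) : ratmap r s :=
  RatMap (coord_map_subproof sigma).

Definition rat_id (r : nat) : ratmap r r := coord_map id.

(* (t_0, ..., t_(r-1)) |-> (t_i, t_j) *)
Definition rat_proj2 (r : nat) (i j : 'I_r) : ratmap r 2 :=
  coord_map (fun a : 'I_2 => if a == 0 then i else j).

Definition rat_swap : ratmap 2 2 := rat_proj2 1 0.

Definition birational (r s : nat) (f : ratmap r s) : Prop :=
  exists g : ratmap s r, is_comp f g (rat_id s) /\ is_comp g f (rat_id r).

(* [acts_on R i j S]: S is R_ij, acting on T^r. *)
Definition acts_on (r : nat) (R : ratmap 2 2) (i j : 'I_r) (S : ratmap r r) :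
    Prop :=
  [/\ forall c, rat_value (R 0 c) (rat_proj2 i j) (S i c),
      forall c, rat_value (R 1 c) (rat_proj2 i j) (S j c)
    & forall k, k != i -> k != j -> forall c, S k c = coord r k c].

(* R^21 R = 1, where R^21 = P R P *)
Definition unitarity (R : ratmap 2 2) : Prop :=
  exists2 R21 : ratmap 2 2,
    is_comp3 rat_swap R rat_swap R21 & is_comp R21 R (rat_id 2).

(* R_12 R_13 R_23 = R_23 R_13 R_12, the factors of T^3 being numbered 0, 1, 2.
   The definedness of both composites is part of the claim. *)
Definition yang_baxter (R : ratmap 2 2) : Prop :=
  exists R12 R13 R23 : ratmap 3 3,
    [/\ acts_on R 0 1 R12, acts_on R 0 2 R13, acts_on R 1 2 R23
      & exists2 S : ratmap 3 3,
          is_comp3 R12 R13 R23 S & is_comp3 R23 R13 R12 S].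

End RationalMaps.

Section Delta.
Variables (K : fieldType) (n : nat).
Implicit Types x y : 'I_n -> K.

(* t_1 ... t_k; the indices i : 'I_n start from 0 *)
Definition partial_prod (k : nat) (t : 'I_n -> K) : K :=
  \prod_(i < n | (i < k)%N) t i.

(* sum over 1 <= j <= k of x_1 ... x_(j-1) y_(j+1) ... y_k *)
Definition Delta (k : nat) x y : K :=
  \sum_(j < n | (j < k)%N)
    (\prod_(i < n | (i < j)%N) x i) * (\prod_(i < n | (j < i < k)%N) y i).

Definition eta x y : K :=
  (partial_prod n x - partial_prod n y) / Delta n x y.

End Delta.

(* R (x, y) = (x', y') satisfies the two families of equations, as rational
   functions of (x, y). *)
Definition R_equations (F : fieldType) (n : nat) (R : ratmap F n 2 2) : Prop :=
  let x := coord F n 2 0 in let y := coord F n 2 1 in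
  let x' := R 0 in let y' := R 1 in
  (forall k : nat, (1 <= k <= n)%N ->
     partial_prod k x' = partial_prod k y + Delta k x y * eta x y) /\
  (forall i : 'I_n, x' i * y' i = x i * y i).

(* Main.v *)
Require Import Defs.
From mathcomp Require Import all_boot all_order all_algebra.
From mathcomp Require Import fraction mpoly reals complex.
From mathcomp Require Import boolp ring.

(** Write X = x_1 ... x_n, Y = y_1 ... y_n, extend the indices cyclically, and
let kappa_k be Delta_n of the words x and y rotated to start at index k (indices
being counted from 0, as below).  Splitting the first or the last letter off
the window of length n + 1 that starts at k gives
<<
  x_k kappa_(k+1) - y_k kappa_k = X - Y,
>>
and by induction on k the displayed conditions become the subtraction-free
closed form
<<
  x'_k = x_k kappa_(k+1) / kappa_k,    y'_k = y_k kappa_k / kappa_(k+1).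
>>
Hence also x'_k = y_k + (X - Y) / kappa_k, y'_k = x_k - (X - Y) / kappa_(k+1),
so that x'_k y'_k = x_k y_k and y'_k + x'_(k+1) = x_k + y_(k+1).

With S the shift of scalar sequences and L_x = S - x (pointwise product by the
periodic sequence x), the two last identities are the coefficients of a
refactorization of a difference operator, [lax_R]:
<<
  L_x L_y = L_(y') L_(x').
>>
As X' = X and Y' = Y, this refactorization exchanges the two products.  A
product of operators L_a in which the products of the entries of the factors
are nonzero and pairwise distinct is determined by the ordered list of these
products ([lax_factorization_unique]): the innermost factor L_b is read off its
kernel, the line of solutions that are multiplied by b_1 ... b_n over n steps,
since the other factors are injective on the sequences with that multiplier.

Unitarity and birationality follow: R applied to (y', x') refactors
L_(y') L_(x') with the products of the entries exchanged once more, that is, in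
the order X, Y, and L_x L_y is such a factorization.  For the Yang-Baxter
equation, both composites send (x, y, z) to a triple (x'', y'', z'') with
<<
  L_x L_y L_z = L_(z'') L_(y'') L_(x'')
>>
and with the same three products, hence they agree ([R_mx_yang_baxter]).

These are identities over any field, applied to the coordinate functions.  What
remains is that no denominator vanishes on the way.  Rational functions that
are quotients of polynomials positive at (1, ..., 1) are nonzero and are stable
under sums, products and quotients; they contain the coordinates, so by the
closed form every composite has its entries among them. *)

Set Implicit Arguments.
Unset Strict Implicit.
Unset Printing Implicit Defensive.

Import Order.TTheory GRing.Theory Num.Theory.
Local Open Scope ring_scope.

(** * Refactorization of periodic difference operators *)

Section Cyclic.
Variables (K : fieldType) (n : nat).
Local Notation N := n.+1.
Implicit Types (x y : 'rV[K]_N) (u : nat -> K) (s : seq 'rV[K]_N).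

(** Cyclic extension of the indices: identities along the word then need no
    separate case at the end of the word. *)
Definition cyc x (k : nat) : K := x 0 (inZp k).

Definition total_prod x : K := \prod_(i < N) cyc x i.

Lemma cycD x k : cyc x (k + N) = cyc x k.
Proof. by rewrite /cyc; congr (x 0 _); apply: val_inj; rewrite /= modnDr. Qed.

Lemma cyc_ord x (i : 'I_N) : cyc x i = x 0 i.
Proof. by rewrite /cyc valZpK. Qed.

Lemma cyc_inj x y : cyc x =1 cyc y -> x = y.
Proof. by move=> e; apply/rowP => i; rewrite -!cyc_ord. Qed.

Lemma periodic_mod (T : Type) (f : nat -> T) k :
  (forall k, f (k + N)%N = f k) -> f (k %% N)%N = f k.
Proof.
move=> fD; rewrite [in RHS](divn_eq k N) addnC.
by elim: (k %/ N)%N => [|q IHq]; rewrite ?mul0n ?addn0 // mulSn addnCA addnC fD.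
Qed.

Lemma cyc_row (f : nat -> K) k :
  (forall k, f (k + N)%N = f k) -> cyc (\row_i f i) k = f k.
Proof. by move=> fD; rewrite /cyc mxE /= periodic_mod. Qed.

Lemma prod_cyc_rot x k : \prod_(i < N) cyc x (k + i) = total_prod x.
Proof.
elim: k => [|k IHk]; first by apply: eq_bigr => i _; rewrite add0n.
rewrite -{}IHk big_ord_recr big_ord_recl /= addSnnS cycD addn0 mulrC.
by congr (_ * _); apply: eq_bigr => i _; rewrite addSnnS.
Qed.

Lemma total_prod_neq0 x k : total_prod x != 0 -> cyc x k != 0.
Proof.
move/prodf_neq0 => x0; have := x0 (inZp k) isT.
by rewrite cyc_ord.
Qed.

(** The Lax operator S - x.  Acting on sequences indexed by all of nat, it needs
    no spectral parameter: the multiplier of quasi-periodic sequences replaces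
    it. *)
Definition lax x u (k : nat) : K := u k.+1 - cyc x k * u k.

(** The head of the list acts first: [:: z; y; x] stands for L_x L_y L_z. *)
Definition lax_seq s u : nat -> K := foldl (fun v x => lax x v) u s.

Definition quasi_periodic (mu : K) u := forall k, u (k + N)%N = mu * u k.

Lemma lax_quasi_periodic mu x u :
  quasi_periodic mu u -> quasi_periodic mu (lax x u).
Proof.
move=> uD k; rewrite /lax -addSn !uD cycD; ring.
Qed.

Lemma lax_ker_iter x u k m : (forall k, lax x u k = 0) ->
  u (k + m)%N = \prod_(i < m) cyc x (k + i) * u k.
Proof.
move=> xu0; elim: m => [|m IHm]; first by rewrite big_ord0 mul1r addn0.
move/eqP: (xu0 (k + m)%N); rewrite subr_eq0 addnS => /eqP->.
by rewrite IHm big_ord_recr /=; ring.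
Qed.

(** A solution of u_(k+1) = x_k u_k is multiplied by the product of the entries
    of x over n steps, which excludes any other multiplier mu. *)
Lemma lax_inj mu x u : quasi_periodic mu u -> mu != total_prod x ->
  (forall k, lax x u k = 0) -> forall k, u k = 0.
Proof.
move=> uD mux xu0 k; have := lax_ker_iter k N xu0.
rewrite prod_cyc_rot uD => /eqP; rewrite -subr_eq0 -mulrBl mulf_eq0.
by rewrite subr_eq0 (negPf mux) => /eqP.
Qed.

Lemma lax_seq_inj mu s u : quasi_periodic mu u -> mu \notin map total_prod s ->
  (forall k, lax_seq s u k = 0) -> forall k, u k = 0.
Proof.
elim: s u => // x s IHs u uD; rewrite inE negb_or => /andP[mux mus] su0.
apply: lax_inj (mux) _ => //; apply: IHs => //; exact: lax_quasi_periodic.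
Qed.

(** The recursion u_(k+1) = x_k u_k + f_k can always be solved; this is what
    cancels a common right factor. *)
Lemma lax_surj x u : exists v, lax x v = u.
Proof.
pose v := fix v k := if k is k'.+1 then u k' + cyc x k' * v k' else 0.
by exists v; apply/funext => k; rewrite /lax /= addrK.
Qed.

Lemma lax_seq0 s k : lax_seq s (fun=> 0) k = 0.
Proof.
elim: s => //= x s IHs; rewrite -[RHS]IHs /lax_seq /=.
by congr (foldl _ _ s _); apply/funext => j; rewrite /lax mulr0 subr0.
Qed.

(** The rightmost factors L_x and L_y of two equal products have the same
    product of entries mu.  The solution u of L_y u = 0 has multiplier mu, and
    the left factors in s have products different from mu, hence are injective
    on such sequences; as the whole product kills u, so does L_x.  Thus
    x_k u_k = u_(k+1) = y_k u_k with u_k nonzero, and x = y. *)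
Lemma lax_factorization_unique s t :
  lax_seq s = lax_seq t -> map total_prod s = map total_prod t ->
  uniq (0 :: map total_prod s) -> s = t.
Proof.
elim: s t => [|x s IHs] [|y t] //= est [exy eprod].
rewrite inE negb_or => /andP[/andP[x0 s0] /andP[xs us]].
pose u k := \prod_(i < k) cyc y i.
have yu0 : lax y u = fun=> 0.
  by apply/funext => k; rewrite /lax /u big_ord_recr /= mulrC subrr.
have u_qp : quasi_periodic (total_prod x) u.
  move=> k; rewrite exy (@lax_ker_iter y u) ?prod_cyc_rot // => j.
  by rewrite yu0.
have xu0 : forall k, lax x u k = 0.
  apply: (@lax_seq_inj (total_prod x) s) => // [|k].
    exact: lax_quasi_periodic.
  by rewrite -[LHS]/(lax_seq (x :: s) u k) est -(lax_seq0 t k) -yu0.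
have xy : x = y.
  apply: cyc_inj => k; have := xu0 k; rewrite -[RHS](congr1 (@^~ k) yu0).
  rewrite /lax => /addrI/oppr_inj/mulIf; apply.
  by apply/prodf_neq0 => i _; apply: total_prod_neq0; rewrite -exy eq_sym.
rewrite -{y exy u yu0 u_qp xu0}xy in est *; congr (_ :: _); apply: IHs => //.
  apply/funext => u; have [v <-] := lax_surj x u.
  exact: (congr1 (@^~ v) est).
by rewrite /= s0.
Qed.

(** * The closed form of R *)

(** Delta_m of the letters at positions k, ..., k + m - 1 of both words; the
    letter at position k + j is the one that the j-th term omits. *)
Definition window_sum x y k m : K :=
  \sum_(j < m)
    \prod_(i < j) cyc x (k + i) * \prod_(j.+1 <= i < m) cyc y (k + i).

Lemma window_sum_recr x y k m :
  window_sum x y k m.+1 =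
    window_sum x y k m * cyc y (k + m) + \prod_(i < m) cyc x (k + i).
Proof.
rewrite /window_sum big_ord_recr /= [X in _ * X]big_geq // mulr1 mulr_suml.
congr (_ + _); apply: eq_bigr => j _.
by rewrite big_nat_recr ?mulrA.
Qed.

Lemma window_sum_recl x y k m :
  window_sum x y k m.+1 =
    \prod_(i < m) cyc y (k.+1 + i) + cyc x k * window_sum x y k.+1 m.
Proof.
elim: m => [|m IHm].
  rewrite window_sum_recr /window_sum !big_ord0; ring.
rewrite window_sum_recr IHm window_sum_recr big_ord_recl.
rewrite [in RHS]big_ord_recr /=.
have -> : \prod_(i < m) cyc x (k + bump 0 i) = \prod_(i < m) cyc x (k.+1 + i).
  by apply: eq_bigr => i _; rewrite addSnnS.
by rewrite addn0 addSnnS; ring.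
Qed.

Definition kappa x y k : K := window_sum x y k N.

Lemma kappaD x y k : kappa x y (k + N) = kappa x y k.
Proof.
apply: eq_bigr => j _; congr (_ * _); apply: eq_bigr => i _;
by rewrite addnAC cycD.
Qed.

(** Both sides are, up to Y, the window sum of length n + 1 from k: removing its
    first letter leaves kappa_(k+1), removing its last one leaves kappa_k. *)
Lemma kappa_rec x y k :
  cyc x k * kappa x y k.+1 =
  cyc y k * kappa x y k + (total_prod x - total_prod y).
Proof.
have := window_sum_recl x y k N.
rewrite window_sum_recr !prod_cyc_rot cycD -!/(kappa _ _ _) => e.
by rewrite -[LHS](addKr (total_prod y)) -e; ring.
Qed.

Definition R_fst x y : 'rV[K]_N :=
  \row_i (cyc x i * kappa x y i.+1 / kappa x y i).
Definition R_snd x y : 'rV[K]_N :=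
  \row_i (cyc y i * kappa x y i / kappa x y i.+1).

Lemma cyc_R_fst x y k :
  cyc (R_fst x y) k = cyc x k * kappa x y k.+1 / kappa x y k.
Proof.
pose f k := cyc x k * kappa x y k.+1 / kappa x y k.
rewrite /R_fst (cyc_row (f := f)) // /f.
by move=> j; rewrite -addSn !kappaD cycD.
Qed.

Lemma cyc_R_snd x y k :
  cyc (R_snd x y) k = cyc y k * kappa x y k / kappa x y k.+1.
Proof.
pose f k := cyc y k * kappa x y k / kappa x y k.+1.
rewrite /R_snd (cyc_row (f := f)) // /f.
by move=> j; rewrite -addSn !kappaD cycD.
Qed.

Section Regular.
Variables x y : 'rV[K]_N.
Hypothesis kappa0 : forall k, kappa x y k != 0.

Lemma R_mul k : cyc (R_fst x y) k * cyc (R_snd x y) k = cyc x k * cyc y k.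
Proof. by rewrite cyc_R_fst cyc_R_snd; field; rewrite !kappa0. Qed.

(** By [kappa_rec], x'_k exceeds y_k by (X - Y) / kappa_k and y'_k falls short
    of x_k by (X - Y) / kappa_(k+1): in y'_k + x'_(k+1) the corrections
    cancel. *)
Lemma R_add k :
  cyc (R_snd x y) k + cyc (R_fst x y) k.+1 = cyc x k + cyc y k.+1.
Proof.
set d := total_prod x - total_prod y.
have R_fstE j : cyc (R_fst x y) j = cyc y j + d / kappa x y j.
  by rewrite cyc_R_fst kappa_rec -/d; field; rewrite kappa0.
have R_sndE j : cyc (R_snd x y) j = cyc x j - d / kappa x y j.+1.
  have -> : d = cyc x j * kappa x y j.+1 - cyc y j * kappa x y j.
    by rewrite kappa_rec /d; ring.
  by rewrite cyc_R_snd; field; rewrite kappa0.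
by rewrite R_fstE R_sndE; ring.
Qed.

Lemma prod_R_fst k : \prod_(i < k) cyc (R_fst x y) i =
  \prod_(i < k) cyc x i * kappa x y k / kappa x y 0.
Proof.
elim: k => [|k IHk]; first by rewrite !big_ord0 mul1r divff.
by rewrite !big_ord_recr /= IHk cyc_R_fst; field; rewrite !kappa0.
Qed.

Lemma total_prod_R_fst : total_prod (R_fst x y) = total_prod x.
Proof.
by rewrite /total_prod prod_R_fst -[X in kappa _ _ X]add0n kappaD mulfK.
Qed.

Lemma total_prod_R_snd : total_prod (R_snd x y) = total_prod y.
Proof.
suff prod_R_snd k : \prod_(i < k) cyc (R_snd x y) i =
    \prod_(i < k) cyc y i * kappa x y 0 / kappa x y k.
  by rewrite /total_prod prod_R_snd -[X in _ / kappa _ _ X]add0n kappaD mulfK.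
elim: k => [|k IHk]; first by rewrite !big_ord0 mul1r divff.
by rewrite !big_ord_recr /= IHk cyc_R_snd; field; rewrite !kappa0.
Qed.

(** [R_mul] and [R_add] are the coefficients of u_k and of u_(k+1). *)
Lemma lax_R u : lax x (lax y u) = lax (R_snd x y) (lax (R_fst x y) u).
Proof.
apply/funext => k; rewrite /lax.
transitivity (u k.+2 - (cyc x k + cyc y k.+1) * u k.+1
              + cyc x k * cyc y k * u k); first by ring.
by rewrite -R_add -R_mul; ring.
Qed.

(** The link with the defining equations: window sums from 0 are the Delta_k,
    and passing from k to k + 1 both sides are multiplied by y_k and increased
    by x_0 ... x_(k-1) (X - Y) / kappa_0, by [kappa_rec] and
    [window_sum_recr]. *)
Lemma prod_R_fst_eta k : \prod_(i < k) cyc (R_fst x y) i =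
  \prod_(i < k) cyc y i
    + window_sum x y 0 k * ((total_prod x - total_prod y) / kappa x y 0).
Proof.
elim: k => [|k IHk]; first by rewrite /window_sum !big_ord0 mul0r addr0.
rewrite big_ord_recr /= cyc_R_fst kappa_rec.
set p := \prod_(i < k) _.
transitivity (p * cyc y k + p / kappa x y k * (total_prod x - total_prod y)).
  by field; rewrite kappa0.
rewrite [in X in X * cyc y k]/p IHk /p prod_R_fst.
by rewrite big_ord_recr /= window_sum_recr add0n; field; rewrite !kappa0.
Qed.

End Regular.

End Cyclic.

Section DeltaWindow.
Variables (K : fieldType) (n : nat).
Implicit Types x y : 'rV[K]_n.+1.

Lemma partial_prodE x k : (k <= n.+1)%N ->
  partial_prod k (x 0) = \prod_(i < k) cyc x i.
Proof.
move=> kn; rewrite (big_ord_widen _ (cyc x) kn).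
by apply: eq_bigr => i _; rewrite cyc_ord.
Qed.

Lemma DeltaE x y k : (k <= n.+1)%N ->
  Delta k (x 0) (y 0) = window_sum x y 0 k.
Proof.
move=> kn; pose f j := \prod_(i < j) cyc x i * \prod_(j.+1 <= i < k) cyc y i.
rewrite [RHS](big_ord_widen _ f kn).
apply: eq_bigr => j jk; congr (_ * _).
  exact: partial_prodE (ltnW (ltn_ord j)).
rewrite big_geq_mkord (big_ord_widen_cond _ _ _ kn).
by apply: eq_big => [i|i _]; rewrite ?cyc_ord.
Qed.

(** Each entry is the quotient of two consecutive partial products. *)
Lemma partial_prod_inj (x y : 'I_n.+1 -> K) : (forall i, x i != 0) ->
  (forall k, (1 <= k <= n.+1)%N -> partial_prod k x = partial_prod k y) ->
  x =1 y.
Proof.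
move=> x0 exy i.
have recr t : partial_prod i.+1 t = partial_prod i t * t i :> K.
  rewrite /partial_prod (bigD1 i) //= mulrC; congr (_ * _).
  by apply: eq_bigl => j; rewrite ltnS ltn_neqAle andbC.
have := exy i.+1 (ltn_ord i); rewrite !recr.
have <- : partial_prod i x = partial_prod i y.
  have [i0|i0] := posnP i; last by apply: exy; rewrite i0 ltnW.
  by rewrite /partial_prod !big_pred0 // => j; rewrite i0.
by apply: mulfI; apply/prodf_neq0.
Qed.

End DeltaWindow.

(** * R acting on two rows of a matrix *)

(** The closed form of R is subtraction-free: on entries taken from such a set
    no denominator vanishes, and the images lie in the set again. *)
Record positive_cone (K : fieldType) (P : K -> Prop) : Prop := PositiveCone {
  coneD : forall a b, P a -> P b -> P (a + b);
  coneM : forall a b, P a -> P b -> P (a * b);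
  coneV : forall a, P a -> P a^-1;
  cone1 : P 1;
  cone_neq0 : forall a, P a -> a != 0
}.

Section Rmatrix.
Variables (K : fieldType) (n r : nat).
Local Notation N := n.+1.
Implicit Types (v : 'M[K]_(r, N)) (i j k : 'I_r).

(** R_ij on r-tuples.  For r = 2, R is [R_mx 0 1] and R^21 is [R_mx 1 0]. *)
Definition R_mx i j v : 'M[K]_(r, N) :=
  \matrix_(a, c) if a == i then R_fst (row i v) (row j v) 0 c
                 else if a == j then R_snd (row i v) (row j v) 0 c
                 else v a c.

Lemma row_R_mx1 i j v : row i (R_mx i j v) = R_fst (row i v) (row j v).
Proof. by apply/rowP => c; rewrite !mxE eqxx. Qed.

Lemma row_R_mx2 i j v :
  i != j -> row j (R_mx i j v) = R_snd (row i v) (row j v).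
Proof. by move=> ij; apply/rowP => c; rewrite !mxE eqxx eq_sym (negPf ij). Qed.

Lemma row_R_mx_id i j k v : k != i -> k != j -> row k (R_mx i j v) = row k v.
Proof. by move=> /negPf ki /negPf kj; apply/rowP => c; rewrite !mxE ki kj. Qed.

Variables (P : K -> Prop) (Pcone : positive_cone P).

Definition mx_in v := forall a c, P (v a c).

Lemma cone_prod I (s : seq I) (Q : pred I) (f : I -> K) :
  (forall a, P (f a)) -> P (\prod_(a <- s | Q a) f a).
Proof.
move=> Pf; elim/big_ind: _ => //; first exact: (cone1 Pcone).
exact: (coneM Pcone).
Qed.

Lemma cone_window_sum (x y : 'rV[K]_N) (k m : nat) :
  (forall c, P (x 0 c)) -> (forall c, P (y 0 c)) -> P (window_sum x y k m.+1).
Proof.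
move=> Px Py; elim: m => [|m IHm]; rewrite window_sum_recr.
  by rewrite /window_sum !big_ord0 mul0r add0r; exact: (cone1 Pcone).
apply: (coneD Pcone); first by apply: (coneM Pcone) => //; exact: Py.
by apply: cone_prod => i; apply: Px.
Qed.

Lemma cone_kappa v a b (k : nat) : mx_in v -> P (kappa (row a v) (row b v) k).
Proof. by move=> Pv; apply: cone_window_sum => c; rewrite mxE. Qed.

Lemma kappa_neq0 v a b (k : nat) : mx_in v -> kappa (row a v) (row b v) k != 0.
Proof. by move=> /cone_kappa Pk; exact: (cone_neq0 Pcone (Pk a b k)). Qed.

Lemma total_prod_row_neq0 v a : mx_in v -> total_prod (row a v) != 0.
Proof.
move=> Pv; apply/prodf_neq0 => c _.
by rewrite cyc_ord mxE; exact: (cone_neq0 Pcone (Pv a c)).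
Qed.

Lemma R_mx_cone i j v : mx_in v -> mx_in (R_mx i j v).
Proof.
move=> Pv a c; rewrite mxE; case: ifP => _; last case: ifP => _; last exact: Pv.
all: rewrite mxE cyc_ord mxE; apply: (coneM Pcone).
all: try by apply: (coneV Pcone); exact: cone_kappa.
all: by apply: (coneM Pcone); [exact: Pv | exact: cone_kappa].
Qed.

Lemma lax_R_mx i j v u : i != j -> mx_in v ->
  lax (row j (R_mx i j v)) (lax (row i (R_mx i j v)) u) =
  lax (row i v) (lax (row j v) u).
Proof.
move=> ij Pv; rewrite row_R_mx1 row_R_mx2 // [RHS]lax_R // => k.
exact: kappa_neq0.
Qed.

Lemma total_prod_R_mx i j v a : i != j -> mx_in v ->
  total_prod (row a (R_mx i j v)) = total_prod (row a v).
Proof.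
move=> ij Pv; have k0 := kappa_neq0 i j _ Pv.
have [->|ai] := eqVneq a i; first by rewrite row_R_mx1 total_prod_R_fst //.
have [->|aj] := eqVneq a j; first by rewrite row_R_mx2 // total_prod_R_snd //.
by rewrite row_R_mx_id.
Qed.

(** After the two steps the operators of rows i and j have the same composite,
    and the same products of entries in the same order, as before: uniqueness of
    the factorization applies. *)
Lemma R_mxK i j v : i != j -> mx_in v ->
  total_prod (row i v) != total_prod (row j v) ->
  R_mx j i (R_mx i j v) = v.
Proof.
move=> ij Pv xy; have ji : j != i by rewrite eq_sym.
have Pw := R_mx_cone i j Pv; set w := R_mx j i _.
have : [:: row j w; row i w] = [:: row j v; row i v].
  apply: lax_factorization_unique.
  - by apply/funext => u; rewrite /lax_seq /= /w !lax_R_mx.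
  - by rewrite /= /w !total_prod_R_mx.
  rewrite /= /w !inE negb_or !total_prod_R_mx // ![0 == _]eq_sym.
  by rewrite !total_prod_row_neq0 // eq_sym xy.
case=> rj ri; apply/row_matrixP => a.
have [->//|ai] := eqVneq a i; have [->//|aj] := eqVneq a j.
by rewrite /w !row_R_mx_id.
Qed.

(** Each side moves the three factors of L_i L_j L_k into the opposite order,
    one exchange of neighbours at a time, so both give factorizations of the
    same operator with the same products in the same order. *)
Lemma R_mx_yang_baxter i j k v : uniq [:: i; j; k] -> mx_in v ->
  uniq [seq total_prod (row a v) | a <- [:: i; j; k]] ->
  R_mx i j (R_mx i k (R_mx j k v)) = R_mx j k (R_mx i k (R_mx i j v)).
Proof.
rewrite /= !inE !negb_or !andbT => /andP[/andP[ij ik] jk] Pv uv.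
have [ji ki kj] : [/\ j != i, k != i & k != j] by split; rewrite eq_sym.
pose v1 := R_mx j k v; pose v2 := R_mx i k v1; set v3 := LHS.
pose w1 := R_mx i j v; pose w2 := R_mx i k w1; set w3 := RHS.
have [Pv1 Pw1] : mx_in v1 /\ mx_in w1 by split; apply: R_mx_cone.
have [Pv2 Pw2] : mx_in v2 /\ mx_in w2 by split; apply: R_mx_cone.
have prodv a : total_prod (row a v3) = total_prod (row a v).
  by rewrite !total_prod_R_mx.
have prodw a : total_prod (row a w3) = total_prod (row a v).
  by rewrite !total_prod_R_mx.
have prodvw a := etrans (prodv a) (esym (prodw a)).
have v3w3 a : a != i -> a != j -> a != k -> row a v3 = row a w3.
  by move=> *; rewrite /v3 /w3 !row_R_mx_id.
have : [:: row i v3; row j v3; row k v3] = [:: row i w3; row j w3; row k w3].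
  apply: lax_factorization_unique.
  - apply/funext => u; rewrite /lax_seq /=.
    transitivity (lax (row i v) (lax (row j v) (lax (row k v) u))).
      rewrite [row k v3]row_R_mx_id // [lax (row j v3) _]lax_R_mx //.
      rewrite [row j _]row_R_mx_id // lax_R_mx // [row i _]row_R_mx_id //.
      by rewrite lax_R_mx.
    rewrite [row i w3]row_R_mx_id // [RHS]lax_R_mx //.
    rewrite [row j w2]row_R_mx_id // [lax (row k w2) _]lax_R_mx //.
    by rewrite [row k w1]row_R_mx_id // lax_R_mx.
  - exact: (eq_map prodvw [:: i; j; k]).
  rewrite /= !prodv !inE !negb_or ![0 == _]eq_sym !total_prod_row_neq0 //=.
  by rewrite ?andbT.
(* Keeps the injectivity of cons from comparing the iterated matrices. *)
clearbody v3 w3; case=> ri rj rk; apply/row_matrixP => a.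
have [->//|ai] := eqVneq a i; have [->//|aj] := eqVneq a j.
by have [->//|ak] := eqVneq a k; apply: v3w3.
Qed.

End Rmatrix.

(** * Substitution in rational functions *)

Section RatValue.
Variables (F : fieldType) (n r s : nat).
Implicit Types (f g : ratfun F n s) (v : 'M[ratfun F n r]_(s, n)).

Lemma poly_at1 v : poly_at 1 v = 1.
Proof. exact: rmorph1. Qed.

Lemma poly_at0 v : poly_at 0 v = 0.
Proof. exact: rmorph0. Qed.

Lemma poly_atD (p q : {mpoly F[s * n]}) v :
  poly_at (p + q) v = poly_at p v + poly_at q v.
Proof. exact: rmorphD. Qed.

Lemma poly_atM (p q : {mpoly F[s * n]}) v :
  poly_at (p * q) v = poly_at p v * poly_at q v.
Proof. exact: rmorphM. Qed.

Lemma tofrac_neq0_at (q : {mpoly F[s * n]}) v :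
  poly_at q v != 0 -> tofrac q != 0.
Proof.
by rewrite tofrac_eq0; apply: contraNneq => ->; rewrite poly_at0.
Qed.

Lemma rat_value_poly (p : {mpoly F[s * n]}) v :
  rat_value (tofrac p) v (poly_at p v).
Proof.
by exists p, 1; rewrite poly_at1 tofrac1 !divr1 oner_eq0.
Qed.

Lemma rat_value_coord v a i : rat_value (Defs.coord F n s a i) v (v a i).
Proof. by rewrite mxE -poly_at_coord; apply: rat_value_poly. Qed.

Lemma rat_value0 v : rat_value 0 v 0.
Proof.
by rewrite -[0 in X in _ _ _ X](poly_at0 v) -tofrac0; apply: rat_value_poly.
Qed.

Lemma rat_value1 v : rat_value 1 v 1.
Proof.
by rewrite -[1 in X in _ _ _ X](poly_at1 v) -tofrac1; apply: rat_value_poly.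
Qed.

Lemma rat_valueD f g v a b :
  rat_value f v a -> rat_value g v b -> rat_value (f + g) v (a + b).
Proof.
move=> [p [q [-> q0 ->]]] [p' [q' [-> q'0 ->]]].
exists (p * q' + p' * q), (q * q'); split.
- rewrite (addf_div _ _ (tofrac_neq0_at q0) (tofrac_neq0_at q'0)).
  by rewrite -!tofracM -tofracD.
- by rewrite poly_atM; exact: mulf_neq0 q0 q'0.
- by rewrite (addf_div _ _ q0 q'0) poly_atD !poly_atM.
Qed.

Lemma rat_valueM f g v a b :
  rat_value f v a -> rat_value g v b -> rat_value (f * g) v (a * b).
Proof.
move=> [p [q [-> q0 ->]]] [p' [q' [-> q'0 ->]]].
exists (p * p'), (q * q'); split.
- by rewrite mulf_div -!tofracM.
- by rewrite poly_atM; exact: mulf_neq0 q0 q'0.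
- by rewrite !poly_atM mulf_div.
Qed.

Lemma rat_valueV f v a : a != 0 -> rat_value f v a -> rat_value f^-1 v a^-1.
Proof.
move=> a0 [p [q [-> q0 e]]]; exists q, p; split.
- by rewrite invf_div.
- by move: a0; rewrite e mulf_eq0 => /norP[p0 _]; exact: p0.
- by rewrite e invf_div.
Qed.

Lemma rat_value_div f g v a b : b != 0 ->
  rat_value f v a -> rat_value g v b -> rat_value (f / g) v (a / b).
Proof. by move=> b0 fa gb; apply: rat_valueM => //; apply: rat_valueV. Qed.

Lemma rat_value_sum I (t : seq I) (Q : pred I) (f : I -> ratfun F n s) v a :
  (forall i, rat_value (f i) v (a i)) ->
  rat_value (\sum_(i <- t | Q i) f i) v (\sum_(i <- t | Q i) a i).
Proof.
move=> fa; elim/big_ind2: _ => //; first exact: rat_value0.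
by move=> *; apply: rat_valueD.
Qed.

Lemma rat_value_prod I (t : seq I) (Q : pred I) (f : I -> ratfun F n s) v a :
  (forall i, rat_value (f i) v (a i)) ->
  rat_value (\prod_(i <- t | Q i) f i) v (\prod_(i <- t | Q i) a i).
Proof.
move=> fa; elim/big_ind2: _ => //; first exact: rat_value1.
by move=> *; apply: rat_valueM.
Qed.

End RatValue.

Section SubstitutionInR.
Variables (F : fieldType) (n r s : nat).
Local Notation N := n.+1.
Implicit Types (v : 'M[ratfun F N r]_(s, N)) (a b : 'I_s).

Lemma rat_value_cyc v a k :
  rat_value (cyc (row a (Defs.coord F N s)) k) v (cyc (row a v) k).
Proof. by rewrite /cyc mxE [in X in _ _ _ X]mxE; apply: rat_value_coord. Qed.

Lemma rat_value_kappa v a b k :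
  rat_value (kappa (row a (Defs.coord F N s)) (row b (Defs.coord F N s)) k) v
    (kappa (row a v) (row b v) k).
Proof.
apply: rat_value_sum => j; apply: rat_valueM; apply: rat_value_prod => i;
exact: rat_value_cyc.
Qed.

Lemma rat_value_R_fst v a b c :
  (forall k, kappa (row a v) (row b v) k != 0) ->
  rat_value (R_fst (row a (Defs.coord F N s)) (row b (Defs.coord F N s)) 0 c) v
    (R_fst (row a v) (row b v) 0 c).
Proof.
move=> k0; rewrite mxE [in X in _ _ _ X]mxE.
apply: rat_value_div (rat_value_kappa _ _ _ _) => //.
exact: rat_valueM (rat_value_cyc _ _ _) (rat_value_kappa _ _ _ _).
Qed.

Lemma rat_value_R_snd v a b c :
  (forall k, kappa (row a v) (row b v) k != 0) ->
  rat_value (R_snd (row a (Defs.coord F N s)) (row b (Defs.coord F N s)) 0 c) v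
    (R_snd (row a v) (row b v) 0 c).
Proof.
move=> k0; rewrite mxE [in X in _ _ _ X]mxE.
apply: rat_value_div (rat_value_kappa _ _ _ _) => //.
exact: rat_valueM (rat_value_cyc _ _ _) (rat_value_kappa _ _ _ _).
Qed.

(** Composing a rational map with R_ij is applying the formulas of R_ij to its
    components, as soon as the denominators of the latter do not vanish. *)
Lemma rat_value_R_mx v i j a c :
  (forall k, kappa (row i v) (row j v) k != 0) ->
  rat_value (R_mx i j (Defs.coord F N s) a c) v (R_mx i j v a c).
Proof.
move=> k0; rewrite mxE [in X in _ _ _ X]mxE.
case: ifP => _; first exact: rat_value_R_fst.
case: ifP => _; first exact: rat_value_R_snd.
exact: rat_value_coord.
Qed.

Lemma total_prod_coord_inj :
  injective (fun a => total_prod (row a (Defs.coord F N s))).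
Proof.
move=> a b eab; apply/eqP; apply: contraT => ab.
(* At this point the product of row a is 0 and that of any other row is 1. *)
pose e : 'M[F]_(s, N) := \matrix_(d, c) (d != a)%:R.
pose P d : {mpoly F[s * N]} := \prod_(c < N) 'X_(mxvec_index d c).
have PE d : total_prod (row d (Defs.coord F N s)) = tofrac (P d).
  by rewrite rmorph_prod; apply: eq_bigr => c _; rewrite cyc_ord !mxE.
have Pe d : (P d).@[fun k => mxvec e 0 k] = (d != a)%:R ^+ N.
  rewrite rmorph_prod -[X in _ ^+ X]card_ord -prodr_const.
  by apply: eq_bigr => c _; rewrite /= mevalXU mxvecE mxE.
move: eab; rewrite /= !PE => /eqP; rewrite tofrac_eq => /eqP Pab.
have := Pe a; rewrite Pab Pe eq_sym ab eqxx expr1n expr0n /= => /eqP.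
by rewrite oner_eq0.
Qed.

End SubstitutionInR.

(** * Rational functions positive at (1, ..., 1) *)

Section Positive.
Variables (F : numFieldType) (n r : nat).

(** Over the complex numbers, 0 < z says that z is real and positive. *)
Definition positive_at_one (f : ratfun F n r) : Prop :=
  exists p q : {mpoly F[r * n]},
    [/\ f = tofrac p / tofrac q, 0 < p.@[fun=> 1] & 0 < q.@[fun=> 1]].

Lemma meval_pos_neq0 (q : {mpoly F[r * n]}) :
  0 < q.@[fun=> 1] -> tofrac q != 0.
Proof.
by rewrite tofrac_eq0; apply: contraTneq => ->; rewrite meval0 ltxx.
Qed.

Lemma positive_at_one_cone : positive_cone positive_at_one.
Proof.
split.
- move=> _ _ [p [q [-> p0 q0]]] [p' [q' [-> p'0 q'0]]].
  exists (p * q' + p' * q), (q * q'); split.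
  + by rewrite (addf_div _ _ (meval_pos_neq0 q0) (meval_pos_neq0 q'0))
      -!tofracM -tofracD.
  + rewrite mevalD !mevalM.
    exact: addr_gt0 (mulr_gt0 p0 q'0) (mulr_gt0 p'0 q0).
  + by rewrite mevalM; exact: mulr_gt0 q0 q'0.
- move=> _ _ [p [q [-> p0 q0]]] [p' [q' [-> p'0 q'0]]].
  exists (p * p'), (q * q'); split.
  + by rewrite mulf_div -!tofracM.
  + by rewrite mevalM; exact: mulr_gt0 p0 p'0.
  + by rewrite mevalM; exact: mulr_gt0 q0 q'0.
- by move=> _ [p [q [-> p0 q0]]]; exists q, p; split; rewrite // invf_div.
- by exists 1, 1; rewrite meval1 ltr01 tofrac1 divr1.
- move=> _ [p [q [-> p0 q0]]].
  by rewrite mulf_neq0 ?invr_eq0 //; apply: meval_pos_neq0.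
Qed.

Lemma coord_positive a c : positive_at_one (Defs.coord F n r a c).
Proof.
rewrite mxE; exists 'X_(mxvec_index a c), 1.
by rewrite mevalXU meval1 ltr01 tofrac1 divr1.
Qed.

End Positive.

(** * R as a rational map *)

Section Main.
Variables (F : numFieldType) (n : nat).
Local Notation N := n.+1.
Local Notation pos := (@positive_at_one F N _).
Local Notation pos_cone := (positive_at_one_cone F N _).

Lemma ratmap_inj r s (f g : ratmap F N r s) : f =2 g -> f = g.
Proof.
case: f g => [f f0] [g g0] /= /matrixP efg; rewrite -efg in g0 *.
by congr RatMap; apply: bool_irrelevance.
Qed.

Lemma positive_mx_neq0 r s (v : 'M[ratfun F N r]_(s, N)) :
  mx_in pos v -> [forall a, [forall i, v a i != 0]].
Proof.
move=> Pv; apply/forallP => a; apply/forallP => i.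
exact: (cone_neq0 pos_cone (Pv a i)).
Qed.

Lemma R_mx_coord_positive r (i j : 'I_r) :
  mx_in pos (R_mx i j (Defs.coord F N r)).
Proof. exact: (R_mx_cone pos_cone _ _ (@coord_positive F N r)). Qed.

Definition rat_R r (i j : 'I_r) : ratmap F N r r :=
  RatMap (positive_mx_neq0 (R_mx_coord_positive i j)).

Lemma rat_R_comp r s (i j : 'I_s) (g h : ratmap F N r s) :
  mx_in pos g -> h =2 R_mx i j g -> is_comp (rat_R i j) g h.
Proof.
move=> Pg hE a c; rewrite hE; apply: rat_value_R_mx => k.
exact: (kappa_neq0 pos_cone _ _ _ Pg).
Qed.

Lemma coord_map_comp r s t (sigma : 'I_t -> 'I_s) (g : ratmap F N r s)
    (h : ratmap F N r t) :
  (forall a c, h a c = g (sigma a) c) -> is_comp (coord_map F N sigma) g h.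
Proof. by move=> hE a c; rewrite hE mxE; apply: rat_value_coord. Qed.

Lemma coord_map_positive r s (sigma : 'I_s -> 'I_r) :
  mx_in pos (coord_map F N sigma).
Proof. by move=> a c; rewrite mxE; apply: coord_positive. Qed.

Lemma rat_RK r (i j : 'I_r) : i != j ->
  is_comp (rat_R j i) (rat_R i j) (rat_id F N r).
Proof.
move=> ij; apply: rat_R_comp; first exact: R_mx_coord_positive.
move=> a c; rewrite /= (R_mxK pos_cone) //; first by rewrite mxE.
  exact: coord_positive.
by rewrite (inj_eq (@total_prod_coord_inj _ _ _)).
Qed.

Lemma acts_on_rat_R r (i j : 'I_r) : i != j ->
  acts_on (rat_R 0 1) i j (rat_R i j).
Proof.
move=> ij; pose sigma (a : 'I_2) := if a == 0 then i else j.
have Pp := @coord_map_positive r 2 sigma.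
have rowp a : row a (rat_proj2 F N i j) = row (sigma a) (Defs.coord F N r).
  by apply/rowP => c; rewrite !mxE.
have RE a : row (sigma a) (rat_R i j) = row a (R_mx 0 1 (rat_proj2 F N i j)).
  rewrite /sigma; have [->|] := eqVneq a 0; first by rewrite !row_R_mx1 !rowp.
  case: a => -[|[|//]] // lt01 _; rewrite (_ : Ordinal _ = 1).
    by rewrite !row_R_mx2 ?rowp.
  exact: val_inj.
have val a c : rat_value (rat_R 0 1 a c) (rat_proj2 F N i j)
    (rat_R i j (sigma a) c).
  move/rowP/(_ c): (RE a); rewrite [LHS]mxE [RHS]mxE => ->.
  apply: rat_value_R_mx => k; exact: (kappa_neq0 pos_cone _ _ _ Pp).
split=> [c|c|k ki kj c]; [exact: (val 0)|exact: (val 1)|].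
by rewrite mxE (negPf ki) (negPf kj).
Qed.

(** Conjugation by the swap turns [rat_R 0 1] into [rat_R 1 0], which is its
    left inverse. *)
Lemma unitarity_rat_R : unitarity (rat_R 0 1).
Proof.
exists (rat_R 1 0); last exact: rat_RK.
pose sw : 'M_(2, N) := rat_swap F N.
have Psw : mx_in pos sw by apply: coord_map_positive.
exists (RatMap (positive_mx_neq0 (R_mx_cone pos_cone 0 1 Psw))).
  exact: rat_R_comp.
apply: coord_map_comp => a c /=.
have rowsw b : row b sw = row (if b == 0 then 1 else 0) (Defs.coord F N 2).
  by apply/rowP => d; rewrite !mxE.
rewrite !mxE !rowsw; by case: a => -[|[|//]].
Qed.

Lemma birational_rat_R : birational (rat_R 0 1 : ratmap F N 2 2).
Proof. by exists (rat_R 1 0); split; apply: rat_RK. Qed.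

Lemma yang_baxter_rat_R : yang_baxter (rat_R 0 1).
Proof.
exists (rat_R 0 1), (rat_R 0 2), (rat_R 1 2).
split; try exact: acts_on_rat_R.
have P2 i j k l := R_mx_cone pos_cone i j (@R_mx_coord_positive 3 k l).
exists (RatMap (positive_mx_neq0 (R_mx_cone pos_cone 0 1 (P2 0 2 1 2)))).
  exists (RatMap (positive_mx_neq0 (P2 0 2 1 2))); apply: rat_R_comp => //.
  - exact: R_mx_coord_positive.
  - exact: P2.
exists (RatMap (positive_mx_neq0 (P2 0 2 0 1))).
  by apply: rat_R_comp => //; exact: R_mx_coord_positive.
apply: rat_R_comp => [|a c]; first exact: P2.
rewrite /= (R_mx_yang_baxter pos_cone) //.
  exact: coord_positive.
by rewrite (map_inj_uniq (@total_prod_coord_inj _ _ _)).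
Qed.

Lemma R_equations_rat_R : R_equations (rat_R 0 1 : ratmap F N 2 2).
Proof.
have k0 k := kappa_neq0 pos_cone 0 1 k (@coord_positive F N 2).
have rE s (v : 'M[ratfun F N 2]_(s, N)) a : v a = row a v 0.
  by apply/funext => c; rewrite mxE.
rewrite /R_equations !(rE _ (Defs.coord F N 2)) !(rE _ (R_mx 0 1 _)).
rewrite row_R_mx1 row_R_mx2 //; split=> [k /andP[_ kN]|i].
  by rewrite /eta !partial_prodE // !DeltaE // (prod_R_fst_eta k0).
by rewrite -!cyc_ord R_mul.
Qed.

Lemma R_equations_unique (R S : ratmap F N 2 2) :
  R_equations R -> R_equations S -> R = S.
Proof.
move=> [R1E R2E] [S1E S2E]; apply: ratmap_inj.
have nz (T : ratmap F N 2 2) a i : T a i != 0.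
  by have /forallP/(_ a)/forallP := rat_mx_neq0 T.
have RS1 : R 0 =1 S 0.
  by apply: partial_prod_inj => // k kN; rewrite R1E // S1E.
have RS2 i : R 1 i = S 1 i.
  by apply: (mulfI (nz R 0 i)); rewrite R2E RS1 S2E.
case=> -[|[|//]] lt i.
  by rewrite (_ : Ordinal lt = 0) ?RS1 //; apply: val_inj.
by rewrite (_ : Ordinal lt = 1) ?RS2 //; apply: val_inj.
Qed.

End Main.
Theorem theorem3p3 (Re : realType) (n : nat) (n_ge1 : (1 <= n)%N) :
  (exists! R : ratmap Re[i]%C n 2 2, R_equations R) /\
  (forall R : ratmap Re[i]%C n 2 2, R_equations R ->
     [/\ birational R, unitarity R & yang_baxter R]).
Proof.
case: n n_ge1 => // n _; split.
  exists (rat_R Re[i]%C n 0 1); split; first exact: R_equations_rat_R.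
  by move=> S; apply: R_equations_unique; apply: R_equations_rat_R.
move=> R RE.
rewrite (R_equations_unique RE (R_equations_rat_R _ _)).
split; first exact: birational_rat_R.
  exact: unitarity_rat_R.
exact: yang_baxter_rat_R.
Qed.
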